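(* Let $1\le p\le n$ and let $(l_1,\dots,l_p)$ be a generic, i.e. linearly independent, family of linear forms on $\mathbf{C}^n$, defining the hyperplane arrangement $\mathcal{A}_p=\{\ker l_1,\dots,\ker l_p\}$. Then the Bernstein ideal $\mathcal{B}(\mathcal{A}_p)=\mathcal{B}(l_1,\dots,l_p)\subset\mathbf{C}[s_1,\dots,s_p]$ is principal, generated by $\prod_{i=1}^{p}(s_i+1)$.
   Context: Let $A_n(\mathbf{C})$ be the Weyl algebra of differential operators with coefficients in $\mathbf{C}[x_1,\dots,x_n]$. For nonzero polynomials $f_1,\dots,f_p\in\mathbf{C}[x_1,\dots,x_n]$, the symbol $f_1^{s_1}\cdots f_p^{s_p}$ generates a free rank-one module over $\mathbf{C}[x_1,\dots,x_n,s_1,\dots,s_p,\frac{1}{f_1\cdots f_p}]$, on which $A_n(\mathbf{C})[s_1,\dots,s_p]$ (the $s_i$ being central variables) acts by $\partial_{x_k}(g\, f_1^{s_1}\cdots f_p^{s_p})=\bigl(\partial_{x_k}g+g\sum_i s_i\frac{\partial_{x_k}f_i}{f_i}\bigr)f_1^{s_1}\cdots f_p^{s_p}$. One sets $f_1^{s_1+1}\cdots f_p^{s_p+1}=f_1\cdots f_p\, f_1^{s_1}\cdots f_p^{s_p}$. The Bernstein ideal $\mathcal{B}(f_1,\dots,f_p)$ is the ideal of all $b\in\mathbf{C}[s_1,\dots,s_p]$ such that $b(s_1,\dots,s_p)\,f_1^{s_1}\cdots f_p^{s_p}\in A_n(\mathbf{C})[s_1,\dots,s_p]\,f_1^{s_1+1}\cdots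 f_p^{s_p+1}$. The Bernstein ideal of an arrangement does not depend on the choice of the linear forms defining its hyperplanes. *)

(* Defs.v *)
From HB Require Import structures.
From mathcomp Require Import all_boot all_order all_algebra ring.
From mathcomp Require Import boolp ssrcomplements mpoly.

Set Implicit Arguments.
Unset Strict Implicit.
Unset Printing Implicit Defensive.

Import GRing.Theory.
Local Open Scope ring_scope.

(* K[x_1, ..., x_n] is {mpoly K[n]}, and a differential operator
   \sum_m a_m(x) d^m is encoded by its normally ordered symbol, the polynomial
   with coefficients a_m in {mpoly {mpoly K[n]}[n]}. *)
Section Connection.
Context (K : comNzRingType) (n : nat) (V : lmodType {mpoly K[n]}).
Context (D : 'I_n -> V -> V).

(* The action of d^m, and of an operator, on V when each d_k acts by D k. *)
Definition dmon (m : 'X_{1..n}) (v : V) : V :=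
  foldr (fun k => iter (m k) (D k)) v (enum 'I_n).

Definition dact (P : {mpoly {mpoly K[n]}[n]}) (v : V) : V :=
  \sum_(m <- msupp P) P@_m *: dmon m v.

Lemma dactwE d P v : (msize P <= d)%N ->
  dact P v = \sum_(m : 'X_{1..n < d}) P@_m *: dmon m v.
Proof.
pose I : subFinType _ := 'X_{1..n < d}.
move=> le_Pd; rewrite /dact (big_mksub I) /=; first last.
- by move=> x /msize_mdeg_lt/leq_trans/(_ le_Pd).
- exact: msupp_uniq.
by rewrite big_rmcond //= => j /memN_msupp_eq0 ->; rewrite scale0r.
Qed.

Lemma dactDl P Q v : dact (P + Q) v = dact P v + dact Q v.
Proof.
pose d := maxn (msize (P + Q)) (maxn (msize P) (msize Q)).
have h1 : (msize (P + Q) <= d)%N by exact: leq_maxl.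
have h2 : (msize P <= d)%N by rewrite /d !leq_max leqnn !orbT.
have h3 : (msize Q <= d)%N by rewrite /d !leq_max leqnn !orbT.
rewrite !(dactwE (d := d)) // -big_split /=; apply: eq_bigr => m _.
by rewrite mcoeffD scalerDl.
Qed.

Lemma dactZ a P v : dact (a *: P) v = a *: dact P v.
Proof.
pose d := maxn (msize (a *: P)) (msize P).
have h1 : (msize (a *: P) <= d)%N by exact: leq_maxl.
have h2 : (msize P <= d)%N by exact: leq_maxr.
rewrite !(dactwE (d := d)) // scaler_sumr; apply: eq_bigr => m _.
by rewrite mcoeffZ scalerA.
Qed.

Lemma dact0 v : dact 0 v = 0.
Proof. by rewrite /dact msupp0 big_nil. Qed.

Lemma dactX m v : dact 'X_[m] v = dmon m v.
Proof. by rewrite /dact msuppX big_seq1 mcoeffX eqxx scale1r. Qed.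

Lemma dmon0 v : dmon 0 v = v.
Proof. by rewrite /dmon; elim: (enum _) => //= k s ->; rewrite mnm0E. Qed.

Lemma dactC a v : dact a%:MP v = a *: v.
Proof.
have -> : a%:MP = a *: 1 :> {mpoly {mpoly K[n]}[n]}.
  by rewrite -mul_mpolyC mulr1.
by rewrite dactZ -mpolyX0 dactX dmon0.
Qed.

Hypothesis DD : forall k u v, D k (u + v) = D k u + D k v.
Hypothesis DZ : forall k a v, D k (a *: v) = a^`M(k) *: v + a *: D k v.
Hypothesis DC : forall i j v, D i (D j v) = D j (D i v).

Lemma D0 k : D k 0 = 0.
Proof. by apply: (addIr (D k 0)); rewrite -DD !add0r. Qed.

Lemma dmonDr m u v : dmon m (u + v) = dmon m u + dmon m v.
Proof.
rewrite /dmon; elim: (enum _) => //= k s ->.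
by elim: (m k) => //= j ->; rewrite DD.
Qed.

Lemma dactDr P u v : dact P (u + v) = dact P u + dact P v.
Proof.
rewrite /dact -big_split; apply: eq_bigr => m _ /=.
by rewrite dmonDr scalerDr.
Qed.

Lemma D_dmon m k v : D k (dmon m v) = dmon (m + U_(k)) v.
Proof.
rewrite /dmon.
have := mem_enum 'I_n k; rewrite inE.
elim: (enum _) (enum_uniq 'I_n) => //= i s IH /andP[iNs us].
have comm_iter j x : D k (iter j (D i) x) = iter j (D i) (D k x).
  by elim: j => //= j <-; rewrite DC.
rewrite inE; case: (eqVneq k i) iNs comm_iter => [<-{i}|neq_ki] iNs comm_iter /=.
  move=> _; rewrite mnmDE mnm1E eqxx addn1 /=; congr (D k (iter _ _ _)).
  elim: s iNs {us IH} => //= j s IH.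
  rewrite inE negb_or => /andP[neq_kj /IH->].
  by rewrite mnmDE mnm1E (negbTE neq_kj) addn0.
move=> ks; rewrite comm_iter IH //.
by rewrite mnmDE mnm1E (negbTE neq_ki) addn0.
Qed.
End Connection.

Section Wconn.
Context (K : comNzRingType) (n : nat).
Local Notation A := {mpoly K[n]}.

Definition dcoef (k : 'I_n) (P : {mpoly A[n]}) : {mpoly A[n]} :=
  map_mpoly (mderiv k) P.

Lemma mcoeff_dcoef k P m : (dcoef k P)@_m = (P@_m)^`M(k).
Proof. exact: mcoeff_map_mpoly. Qed.

Lemma dcoefD k P Q : dcoef k (P + Q) = dcoef k P + dcoef k Q.
Proof. exact: raddfD. Qed.

Lemma dcoef0 k : dcoef k 0 = 0.
Proof. exact: raddf0. Qed.

Lemma dcoefZ k a P : dcoef k (a *: P) = a^`M(k) *: P + a *: dcoef k P.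
Proof.
apply/mpolyP => m; rewrite mcoeff_dcoef mcoeffZ mderivM.
by rewrite mcoeffD !mcoeffZ mcoeff_dcoef.
Qed.

Lemma dcoefX k m : dcoef k 'X_[m] = 0.
Proof.
apply/mpolyP => m'; rewrite mcoeff_dcoef mcoeffX mcoeff0.
by rewrite -mpolyC_nat mderivC.
Qed.

Lemma dcoefXM k m P : dcoef k ('X_[m] * P) = 'X_[m] * dcoef k P.
Proof.
elim/mpolyind: P => [|a m' P _ _ IH]; first by rewrite mulr0 dcoef0 mulr0.
rewrite mulrDr !dcoefD IH mulrDr; congr (_ + _).
rewrite -scalerAr -mpolyXD !dcoefZ !dcoefX !scaler0 !addr0.
by rewrite -scalerAr -mpolyXD.
Qed.

Lemma dcoefC i j P : dcoef i (dcoef j P) = dcoef j (dcoef i P).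
Proof.
apply/mpolyP => m; transitivity (P@_m^`M(j)^`M(i)).
  by rewrite mcoeff_dcoef; congr mderiv; exact: mcoeff_dcoef.
transitivity (P@_m^`M(i)^`M(j)); first exact: mderiv_comm.
by rewrite mcoeff_dcoef; congr mderiv; rewrite mcoeff_dcoef.
Qed.

(* Left composition by d_k: d_k o (a d^m) = (d_k a) d^m + a d^(m + e_k). *)
Definition wconn (k : 'I_n) (P : {mpoly A[n]}) : {mpoly A[n]} :=
  dcoef k P + 'X_k * P.

Lemma wconnD k P Q : wconn k (P + Q) = wconn k P + wconn k Q.
Proof. by rewrite /wconn dcoefD mulrDr addrACA. Qed.

Lemma wconnZ k a P : wconn k (a *: P) = a^`M(k) *: P + a *: wconn k P.
Proof. by rewrite /wconn scalerDr addrA -scalerAr dcoefZ. Qed.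

Lemma wconnC i j P : wconn i (wconn j P) = wconn j (wconn i P).
Proof.
have E k l : wconn k (wconn l P) = dcoef k (dcoef l P) +
    ('X_l * dcoef k P + 'X_k * dcoef l P) + 'X_[U_(k) + U_(l)] * P.
  rewrite /wconn dcoefD (dcoefXM k U_(l)%MM) mulrDr -!addrA.
  by congr (_ + (_ + (_ + _))); rewrite mulrA -mpolyXD.
rewrite (E i j) (E j i) (dcoefC i j) (addmC U_(i)%MM U_(j)%MM).
by move: (dcoef _ _) ('X_j * _) ('X_i * _) (_ * P) => a b c d; rewrite (addrC b).
Qed.

Lemma wconnX k m : wconn k 'X_[m] = 'X_[m + U_(k)].
Proof.
by rewrite /wconn -mpolyXD addmC dcoefX add0r.
Qed.

Lemma dmon_wconn1 m : dmon wconn m 1 = 'X_[m].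
Proof.
rewrite -mpolyX0 [in RHS](multinomUE_id m) -[index_enum _]enumT /dmon.
elim: (enum _) => /= [|i s ->]; first by rewrite big_nil.
rewrite big_cons addmC; elim: (m i) => [|j IH] /=.
  by rewrite mulm0n addm0.
by rewrite IH wconnX mulmSr addmA.
Qed.

Lemma dact_wconn1 P : dact wconn P 1 = P.
Proof.
by rewrite [RHS]mpolyE; apply: eq_bigr => m _; rewrite dmon_wconn1.
Qed.

Context (V : lmodType A) (D : 'I_n -> V -> V).
Hypothesis DD : forall k u v, D k (u + v) = D k u + D k v.
Hypothesis DZ : forall k a v, D k (a *: v) = a^`M(k) *: v + a *: D k v.
Hypothesis DC : forall i j v, D i (D j v) = D j (D i v).

Lemma dact_D k P v : D k (dact D P v) = dact D (wconn k P) v.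
Proof.
elim/mpolyind: P => [|a m P _ _ IH].
  by rewrite /wconn dcoef0 mulr0 addr0 dact0 D0.
rewrite dactDl DD wconnD dactDl IH wconnZ wconnX; congr (_ + _).
by rewrite dactDl !dactZ !dactX DZ D_dmon.
Qed.

Lemma dact_dmon m P v : dmon D m (dact D P v) = dact D (dmon wconn m P) v.
Proof.
rewrite [in LHS]/dmon [in RHS]/dmon; elim: (enum _) => //= i s ->.
by elim: (m i) => //= j ->; rewrite dact_D.
Qed.

Lemma dactA P Q v : dact D P (dact D Q v) = dact D (dact wconn P Q) v.
Proof.
have -> : dact wconn P Q = \sum_(m <- msupp P) P@_m *: dmon wconn m Q by [].
rewrite {1}/dact.
elim: (msupp P) => [|m s IH]; first by rewrite !big_nil dact0.
by rewrite !big_cons dactDl dactZ IH dact_dmon.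
Qed.
End Wconn.

(* The Weyl algebra A_n(K); its product is the composition of operators,
   not that of the polynomials of symbols. *)
Definition weyl (n : nat) (K : comNzRingType) : Type := {mpoly {mpoly K[n]}[n]}.

Section Weyl.
Context (n : nat) (K : comNzRingType).
HB.instance Definition _ := GRing.Zmodule.copy (weyl n K) {mpoly {mpoly K[n]}[n]}.

Definition weyl_mul (P Q : weyl n K) : weyl n K := dact (@wconn K n) P Q.
Definition weyl1 : weyl n K := (1 : {mpoly {mpoly K[n]}[n]}).

Lemma weyl_mulA : associative weyl_mul.
Proof.
by move=> P Q S; apply: dactA; [exact: wconnD|exact: wconnZ|exact: wconnC].
Qed.
Lemma weyl_mul1l : left_id weyl1 weyl_mul.
Proof. by move=> P; rewrite /weyl_mul /weyl1 dactC scale1r. Qed.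
Lemma weyl_mul1r : right_id weyl1 weyl_mul.
Proof. exact: dact_wconn1. Qed.
Lemma weyl_mulDl : left_distributive weyl_mul +%R.
Proof. by move=> P Q S; apply: dactDl. Qed.
Lemma weyl_mulDr : right_distributive weyl_mul +%R.
Proof. by move=> P Q S; apply: dactDr; exact: wconnD. Qed.
Lemma weyl1_neq0 : weyl1 != 0.
Proof. exact: oner_neq0. Qed.

HB.instance Definition _ := GRing.Zmodule_isNzRing.Build (weyl n K)
  weyl_mulA weyl_mul1l weyl_mul1r weyl_mulDl weyl_mulDr weyl1_neq0.
End Weyl.

Section WeylGenerators.
Context (n : nat) (K : comNzRingType).

Definition weylC (a : {mpoly K[n]}) : weyl n K := a%:MP_[n].
Definition weylD (k : 'I_n) : weyl n K := ('X_k : {mpoly {mpoly K[n]}[n]}).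

Lemma dmonU (V : lmodType {mpoly K[n]}) (D : 'I_n -> V -> V) k v :
  dmon D U_(k) v = D k v.
Proof.
rewrite /dmon; have := mem_enum 'I_n k; rewrite inE.
elim: (enum _) (enum_uniq 'I_n) => //= i s IH /andP[iNs us].
rewrite inE mnm1E; case: (eqVneq k i) iNs => [<-{i}|neq_ki] iNs /=; last exact: IH.
move=> _; congr (D k _); elim: s iNs {us IH} => //= j s IH.
by rewrite inE negb_or mnm1E => /andP[/negbTE-> /IH].
Qed.

Lemma weylDC k a :
  weylD k * weylC a = weylC a * weylD k + weylC (a^`M(k)).
Proof.
rewrite [LHS]dactX dmonU [weylC a * _]dactC -mul_mpolyC.
rewrite /wconn addrC (commr_mpolyX U_(k)%MM a%:MP); congr (_ + _).
by apply/mpolyP => m; rewrite mcoeff_dcoef !mcoeffC -mpolyC_nat mulrC mderiv_mulC mulrC.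
Qed.

Lemma weylDD j k : weylD j * weylD k = weylD k * weylD j.
Proof.
rewrite [LHS]dactX dmonU [RHS]dactX dmonU.
by rewrite [LHS]wconnX [RHS]wconnX addmC.
Qed.

Lemma weylCM a b : weylC (a * b) = weylC a * weylC b.
Proof. by rewrite [RHS]dactC /weylC mpolyCM mul_mpolyC. Qed.
End WeylGenerators.

Section FieldIdentities.
Context (F : fieldType).
Implicit Types a b u v : F.

Fact quotient_rule_wd a b u v a' b' u' v' : b != 0 -> v != 0 ->
    a * v = u * b -> a' * v + a * v' = u' * b + u * b' ->
  (u' * v - u * v') / v ^+ 2 = (a' * b - a * b') / b ^+ 2.
Proof.
move=> bN0 vN0 E1 E2.
have Ea : a = u * b / v by rewrite -E1 mulfK.
have -> : a' = (u' * b + u * b' - a * v') / v by rewrite -E2 addrK mulfK.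
by rewrite Ea; field; rewrite bN0 vN0.
Qed.

Fact quotient_ruleD a b u v a' b' u' v' : b != 0 -> v != 0 ->
  ((a' * v + a * v' + (u' * b + u * b')) * (b * v) -
     (a * v + u * b) * (b' * v + b * v')) / (b * v) ^+ 2 =
  (a' * b - a * b') / b ^+ 2 + (u' * v - u * v') / v ^+ 2.
Proof. by move=> bN0 vN0; field; rewrite bN0 vN0. Qed.

Fact quotient_ruleM a b u v a' b' u' v' : b != 0 -> v != 0 ->
  ((a' * u + a * u') * (b * v) - a * u * (b' * v + b * v')) / (b * v) ^+ 2 =
  (a' * b - a * b') / b ^+ 2 * (u / v) + a / b * ((u' * v - u * v') / v ^+ 2).
Proof. by move=> bN0 vN0; field; rewrite bN0 vN0. Qed.

Fact quotient_ruleC a b ad bd ae be ade bde : b != 0 ->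
  ((ade * b + ae * bd - (ad * be + a * bde)) * (b * b) -
     (ae * b - a * be) * (bd * b + b * bd)) / (b * b) ^+ 2 =
  ((ade * b + ad * be - (ae * bd + a * bde)) * (b * b) -
     (ad * b - a * bd) * (be * b + b * be)) / (b * b) ^+ 2.
Proof. by move=> bN0; congr (_ / _); ring. Qed.
End FieldIdentities.

Section Localization.
Local Open Scope quotient_scope.
Context (A : idomainType).
Local Notation "x %:F" := (@FracField.tofrac A x).

Lemma frac_repr (q : {fraction A}) :
  q = (\n_(repr q))%:F / (\d_(repr q))%:F.
Proof.
have dN0 : (\d_(repr q))%:F != 0 :> {fraction A}.
  by rewrite tofrac_eq0 denom_ratioP.
apply: (mulIf dN0); rewrite mulfVK //.
rewrite -{1}[q]reprK; move: (repr q) => x {dN0}.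
unlock FracField.tofrac; rewrite -[LHS]FracField.pi_mul; apply/eqmodP => /=.
rewrite FracField.equivfE /FracField.mulf !numden_Ratio ?oner_eq0 ?mulr1 ?mulf_neq0 ?denom_ratioP ?oner_eq0 //.
by rewrite mulrC.
Qed.

(* The extension of a derivation d by the quotient rule; see fracdE. *)
Definition fracd (d : A -> A) (q : {fraction A}) : {fraction A} :=
  let r := repr q in
  (d \n_r * \d_r - \n_r * d \d_r)%:F / (\d_r)%:F ^+ 2.

Section Derivation.
Context (d : A -> A).
Hypothesis dD : {morph d : a b / a + b}.
Hypothesis dM : forall a b, d (a * b) = d a * b + a * d b.

Lemma fracdE (a b : A) : b != 0 ->
  fracd d (a%:F / b%:F) = (d a * b - a * d b)%:F / b%:F ^+ 2.
Proof.
move=> bN0; rewrite /fracd; set q := a%:F / b%:F; set r := repr q.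
have := frac_repr q; rewrite -/r; have rN0 := denom_ratioP r.
move: (\n_r) (\d_r) rN0 => u v vN0 {r}; rewrite /q => {q} E.
have BN0 : b%:F != 0 by rewrite tofrac_eq0.
have VN0 : v%:F != 0 by rewrite tofrac_eq0.
move/eqP: E; rewrite eqr_div // -!tofracM tofrac_eq => /eqP E1.
have E2 := congr1 d E1; rewrite !dM in E2.
rewrite !(tofracB, tofracM); apply: quotient_rule_wd => //.
  by rewrite -!tofracM E1.
by rewrite -!tofracM -!tofracD E2.
Qed.

Lemma dF0 : d 0 = 0.
Proof. by apply: (addIr (d 0)); rewrite -dD !add0r. Qed.
Lemma dF1 : d 1 = 0.
Proof. by apply: (addIr (d 1)); rewrite add0r -{3}[1]mulr1 dM mulr1 mul1r. Qed.
Lemma dFN a : d (- a) = - d a.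
Proof. by apply: (addIr (d a)); rewrite -dD !addNr dF0. Qed.

Lemma fracd_tofrac a : fracd d a%:F = (d a)%:F.
Proof.
rewrite -[a%:F]divr1 -tofrac1 fracdE ?oner_neq0 //.
by rewrite dF1 mulr0 subr0 mulr1 tofrac1 expr1n divr1.
Qed.

Lemma fracP (q : {fraction A}) : exists a b, b != 0 /\ q = a%:F / b%:F.
Proof. by exists (\n_(repr q)), (\d_(repr q)); split; [exact: denom_ratioP|exact: frac_repr]. Qed.

Lemma fracdD : {morph fracd d : p q / p + q}.
Proof.
move=> p q; case: (fracP p) => a [b [bN0 ->]]; case: (fracP q) => a' [b' [b'N0 ->]].
have BN0 : b%:F != 0 by rewrite tofrac_eq0.
have B'N0 : b'%:F != 0 by rewrite tofrac_eq0.
rewrite addf_div // -!tofracM -tofracD !fracdE ?mulf_neq0 //.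
rewrite dD !dM !(tofracB, tofracD, tofracM).
exact: quotient_ruleD.
Qed.

Lemma fracdM p q : fracd d (p * q) = fracd d p * q + p * fracd d q.
Proof.
case: (fracP p) => a [b [bN0 ->]]; case: (fracP q) => a' [b' [b'N0 ->]].
have BN0 : b%:F != 0 by rewrite tofrac_eq0.
have B'N0 : b'%:F != 0 by rewrite tofrac_eq0.
rewrite mulf_div -!tofracM !fracdE ?mulf_neq0 //.
rewrite !dM !(tofracB, tofracD, tofracM).
exact: quotient_ruleM.
Qed.
End Derivation.

Lemma fracdC (d e : A -> A) :
    {morph d : a b / a + b} -> (forall a b, d (a * b) = d a * b + a * d b) ->
    {morph e : a b / a + b} -> (forall a b, e (a * b) = e a * b + a * e b) ->
    (forall a, d (e a) = e (d a)) ->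
  forall q, fracd d (fracd e q) = fracd e (fracd d q).
Proof.
move=> dD dM eD eM de q; case: (fracP q) => a [b [bN0 ->]].
have BN0 : b%:F != 0 by rewrite tofrac_eq0.
rewrite (fracdE eM) // (fracdE dM) // -!tofracXn.
rewrite (fracdE dM) ?expf_neq0 // (fracdE eM) ?expf_neq0 //.
rewrite !expr2 !(dD, eD, dFN dD, dFN eD, dM, eM) !de.
rewrite !(tofracN, tofracB, tofracD, tofracM).
exact: quotient_ruleC.
Qed.

Context (f : A).
(* A[1 / f] inside the fraction field; it is A itself when f = 0. *)
Definition loc_pred : {pred {fraction A}} :=
  fun q => `[< exists g k, q = g%:F / f%:F ^+ k >].

Lemma loc_predP q :
  reflect (exists g k, q = g%:F / f%:F ^+ k) (q \in loc_pred).
Proof. exact: asboolP. Qed.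

Lemma loc_tofrac a : a%:F \in loc_pred.
Proof. by apply/loc_predP; exists a, 0%N; rewrite expr0 divr1. Qed.

Lemma loc_pred_subring : subring_closed loc_pred.
Proof.
have [f0|fN0] := eqVneq f 0.
  have E q : q \in loc_pred -> exists a, q = a%:F.
    case/loc_predP => a [[|k] ->]; first by exists a; rewrite expr0 divr1.
    by exists 0; rewrite f0 tofrac0 exprS mul0r invr0 mulr0.
  split=> [|p q /E[a ->] /E[b ->]|p q /E[a ->] /E[b ->]].
  - by rewrite -tofrac1 loc_tofrac.
  - by rewrite -tofracB loc_tofrac.
  - by rewrite -tofracM loc_tofrac.
have FN0 k : f%:F ^+ k != 0 by rewrite expf_neq0 // tofrac_eq0.
split=> [|p q /loc_predP[a [k ->]] /loc_predP[b [l ->]]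
         |p q /loc_predP[a [k ->]] /loc_predP[b [l ->]]].
- by rewrite -tofrac1 loc_tofrac.
- apply/loc_predP; exists (a * f ^+ l - b * f ^+ k), (k + l)%N.
  rewrite exprD tofracB !tofracM !tofracXn -mulNr addf_div //.
  by rewrite mulNr.
- apply/loc_predP; exists (a * b), (k + l)%N.
  by rewrite tofracM exprD mulf_div.
Qed.
HB.instance Definition _ :=
  GRing.isSubringClosed.Build {fraction A} loc_pred loc_pred_subring.

Definition localization : Type := {q : {fraction A} | q \in loc_pred}.
HB.instance Definition _ := SubType.on localization.
HB.instance Definition _ := [Choice of localization by <:].
HB.instance Definition _ := [SubChoice_isSubComNzRing of localization by <:].

Definition loc_of (a : A) : localization := Sub a%:F (loc_tofrac a).

Fact loc_inv_subproof : f%:F^-1 \in loc_pred.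
Proof. by apply/loc_predP; exists 1, 1%N; rewrite tofrac1 div1r expr1. Qed.
Definition loc_inv : localization := Sub f%:F^-1 loc_inv_subproof.

Section Derivation.
Context (d : A -> A).
Hypothesis dD : {morph d : a b / a + b}.
Hypothesis dM : forall a b, d (a * b) = d a * b + a * d b.
Lemma fracd_loc q : q \in loc_pred -> fracd d q \in loc_pred.
Proof.
case/loc_predP => a [k ->]; apply/loc_predP.
have [f0|fN0] := eqVneq f 0; last first.
  exists (d a * f ^+ k - a * d (f ^+ k)), (k * 2)%N.
  by rewrite -tofracXn fracdE ?expf_neq0 // exprM tofracXn.
case: k => [|k].
  by exists (d a), 0%N; rewrite expr0 !divr1 fracd_tofrac.
exists 0, 0%N; rewrite f0 tofrac0 exprS mul0r invr0 mulr0 -tofrac0 fracd_tofrac //.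
by rewrite dF0 // tofrac0 mul0r.
Qed.
End Derivation.
End Localization.

Section LocalizationModule.
Context (A : idomainType) (f : A).
Local Notation "x %:F" := (@FracField.tofrac A x).

Lemma loc_ofD (a b : A) : loc_of f (a + b) = loc_of f a + loc_of f b.
Proof. by apply: val_inj; rewrite /= tofracD. Qed.
Lemma loc_ofM (a b : A) : loc_of f (a * b) = loc_of f a * loc_of f b.
Proof. by apply: val_inj; rewrite /= tofracM. Qed.
Lemma loc_of1 : loc_of f 1 = 1.
Proof. by apply: val_inj; rewrite /= tofrac1. Qed.

Definition loc_scale (a : A) (q : localization f) : localization f :=
  loc_of f a * q.
Fact loc_scaleA a b q : loc_scale a (loc_scale b q) = loc_scale (a * b) q.
Proof. by rewrite /loc_scale loc_ofM mulrA. Qed.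
Fact loc_scale1 : left_id 1 loc_scale.
Proof. by move=> q; rewrite /loc_scale loc_of1 mul1r. Qed.
Fact loc_scaleDr : right_distributive loc_scale +%R.
Proof. by move=> a p q; rewrite /loc_scale mulrDr. Qed.
Fact loc_scaleDl q : {morph loc_scale^~ q : a b / a + b}.
Proof. by move=> a b; rewrite /loc_scale loc_ofD mulrDl. Qed.
HB.instance Definition _ := GRing.Zmodule_isLmodule.Build A (localization f)
  loc_scaleA loc_scale1 loc_scaleDr loc_scaleDl.

Lemma loc_scaleE a (q : localization f) : a *: q = loc_of f a * q.
Proof. by []. Qed.

Section Derivation.
Context (d : A -> A).
Hypothesis dD : {morph d : a b / a + b}.
Hypothesis dM : forall a b, d (a * b) = d a * b + a * d b.

Definition locd (q : localization f) : localization f :=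
  Sub (fracd d (val q)) (fracd_loc dD dM (valP q)).

Lemma locdD (p q : localization f) : locd (p + q) = locd p + locd q.
Proof. by apply: val_inj => /=; exact: fracdD. Qed.
Lemma locdM (p q : localization f) : locd (p * q) = locd p * q + p * locd q.
Proof. by apply: val_inj => /=; exact: fracdM. Qed.
Lemma locd_of a : locd (loc_of f a) = loc_of f (d a).
Proof. by apply: val_inj => /=; exact: fracd_tofrac. Qed.
End Derivation.
End LocalizationModule.

Fact nablaC_ring (R : comNzRingType) (g a b e u v w : R) :
  a + (b * w + g * u) + (e + g * w) * v = a + (e * v + g * u) + (b + g * v) * w.
Proof. by ring. Qed.

Definition fprod (A : idomainType) (p : nat) (f : 'I_p -> A) : A := \prod_i f i.

Section LogarithmicConnection.
Context (A : idomainType) (n p : nat) (d : 'I_n -> A -> A).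
Context (s f : 'I_p -> A).
Hypothesis dD : forall k, {morph d k : a b / a + b}.
Hypothesis dM : forall k a b, d k (a * b) = d k a * b + a * d k b.
Local Notation h := (fprod f).
Local Notation L := (localization h).
Local Notation "x %:F" := (@FracField.tofrac A x).

(* (d_k f_i) / f_i when h != 0, by val_dlog; written over the common
   denominator h so that it lies in the localization by construction. *)
Definition dlog (k : 'I_n) (i : 'I_p) : L :=
  loc_of h (d k (f i) * \prod_(j | j != i) f j) * loc_inv h.

Lemma val_dlog k i : h != 0 -> val (dlog k i) = (d k (f i))%:F / (f i)%:F.
Proof.
move=> hN0; rewrite /dlog /=; move: hN0; rewrite /fprod (bigD1 i) //= mulf_eq0 negb_or.
set g := \prod_(j | j != i) f j => /andP[fN0 gN0].
rewrite !tofracM invfM mulrACA [X in _ * X]mulrC mulVf ?mulr1 //.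
by rewrite tofrac_eq0.
Qed.

(* The action of d_k on g f_1^s_1 ... f_p^s_p, read on the coefficient g. *)
Definition nabla (k : 'I_n) (g : L) : L :=
  locd (dD k) (dM k) g + g * \sum_i loc_of h (s i) * dlog k i.

Hypothesis dC : forall k l a, d k (d l a) = d l (d k a).
Hypothesis ds : forall k i, d k (s i) = 0.

Local Notation dx k := (locd (dD k) (dM k)).

Lemma dxC k l (g : L) : dx k (dx l g) = dx l (dx k g).
Proof. by apply: val_inj => /=; apply: fracdC. Qed.

Lemma dx0 k : dx k 0 = 0 :> L.
Proof. by apply: (addIr (dx k 0)); rewrite -[LHS]locdD !add0r. Qed.

Lemma dx_dlogC k l i : dx k (dlog l i) = dx l (dlog k i).
Proof.
have [h0|hN0] := eqVneq h 0.
  have E j : dlog j i = 0.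
    by apply: val_inj; rewrite /dlog /= h0 tofrac0 invr0 mulr0.
  by rewrite !E !dx0.
have fN0 : f i != 0 by move: hN0; rewrite /fprod (bigD1 i) //= mulf_eq0 negb_or => /andP[].
apply: val_inj => /=; rewrite -/(dlog k i) -/(dlog l i).
rewrite [X in fracd _ X](val_dlog l i hN0) [X in _ = fracd _ X](val_dlog k i hN0).
rewrite (fracdE (dM k)) // (fracdE (dM l)) // dC.
by rewrite [d l _ * d k _]mulrC.
Qed.

Lemma dx_sc k (a : A) : dx k (loc_of h a) = loc_of h (d k a).
Proof. exact: locd_of. Qed.

Lemma nablaD k g g' : nabla k (g + g') = nabla k g + nabla k g'.
Proof. by rewrite /nabla locdD mulrDl addrACA. Qed.

Lemma nablaZ k (a : A) (g : L) :
  nabla k (a *: g) = d k a *: g + a *: nabla k g.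
Proof. by rewrite /nabla !loc_scaleE locdM dx_sc mulrDr addrA mulrA. Qed.

Lemma nablaC k l g : nabla k (nabla l g) = nabla l (nabla k g).
Proof.
pose c k := \sum_i loc_of h (s i) * dlog k i.
have cC : dx k (c l) = dx l (c k).
  have dx_sum j (G : 'I_p -> L) : dx j (\sum_(i < p) G i) = \sum_(i < p) dx j (G i).
    move: (index_enum _) => r; elim: r => [|i r IH].
      by rewrite !big_nil dx0.
    by rewrite !big_cons locdD IH.
  rewrite /c !dx_sum; apply: eq_bigr => i _.
  have sc0 j : loc_of h (d j (s i)) = 0.
    by rewrite ds; apply: val_inj; rewrite /= tofrac0.
  by rewrite locdM [RHS]locdM !dx_sc !sc0 !mul0r !add0r dx_dlogC.
rewrite /nabla -/(c k) -/(c l) !locdD !locdM cC (dxC k l).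
move: (dx l (dx k g)) (dx k g) (dx l g) (dx l (c k)) (c k) (c l) => a b e u v w.
exact: nablaC_ring.
Qed.
End LogarithmicConnection.

Section PowerModule.
Context (K : idomainType) (n p : nat) (s : 'I_p -> K) (f : 'I_p -> {mpoly K[n]}).
Local Notation A := {mpoly K[n]}.

Definition mder (k : 'I_n) (a : A) : A := a^`M(k).
Fact mderD k : {morph mder k : a b / a + b}.
Proof. exact: mderivD. Qed.
Fact mderM k (a b : A) : mder k (a * b) = mder k a * b + a * mder k b.
Proof. exact: mderivM. Qed.
Fact mderC k l (a : A) : mder k (mder l a) = mder l (mder k a).
Proof. exact: mderiv_comm. Qed.
Fact mder_const k i : mder k (s i)%:MP = 0.
Proof. exact: mderivC. Qed.

Definition pnabla :
    'I_n -> localization (fprod f) -> localization (fprod f) :=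
  nabla (fun i => (s i)%:MP) mderD mderM.

Fact pnablaD k g g' : pnabla k (g + g') = pnabla k g + pnabla k g'.
Proof. exact: nablaD. Qed.
Fact pnablaZ k (a : A) g : pnabla k (a *: g) = a^`M(k) *: g + a *: pnabla k g.
Proof. exact: nablaZ. Qed.
Fact pnablaC k l g : pnabla k (pnabla l g) = pnabla l (pnabla k g).
Proof. by apply: nablaC; [exact: mderC|exact: mder_const]. Qed.
End PowerModule.

(* The free rank-one module A[1 / (f_1 ... f_p)] f_1^s_1 ... f_p^s_p, with
   A = K[x_1, ..., x_n] and s_i in K; an element is encoded by its coefficient,
   and the type depends on s through its weyl n K-module structure. *)
Definition power_module (K : idomainType) (n p : nat)
    (s : 'I_p -> K) (f : 'I_p -> {mpoly K[n]}) : Type :=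
  localization (fprod f).

Section PowerModuleTheory.
Context (K : idomainType) (n p : nat) (s : 'I_p -> K) (f : 'I_p -> {mpoly K[n]}).
Local Notation M := (power_module s f).

HB.instance Definition _ := GRing.Zmodule.copy M (localization (fprod f)).

Definition power_scale (P : weyl n K) (g : M) : M := dact (@pnabla K n p s f) P g.

Fact power_scaleA P Q g :
  power_scale P (power_scale Q g) = power_scale (P * Q) g.
Proof.
by apply: dactA; [exact: pnablaD|exact: pnablaZ|exact: pnablaC].
Qed.
Fact power_scale1 : left_id 1 power_scale.
Proof. by move=> g; rewrite /power_scale [LHS]dactC [LHS]scale1r. Qed.
Fact power_scaleDr : right_distributive power_scale +%R.
Proof. by move=> P g g'; apply: dactDr; exact: pnablaD. Qed.
Fact power_scaleDl g : {morph power_scale^~ g : P Q / P + Q}.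
Proof. by move=> P Q; apply: dactDl. Qed.
HB.instance Definition _ := GRing.Zmodule_isLmodule.Build (weyl n K) M
  power_scaleA power_scale1 power_scaleDr power_scaleDl.

(* g f_1^s_1 ... f_p^s_p *)
Definition gpower (g : localization (fprod f)) : M := g.

Lemma weylC_gpower a g : weylC a *: gpower g = gpower (loc_of (fprod f) a * g).
Proof. exact: dactC. Qed.

Lemma weylD_gpower k g : weylD K k *: gpower g =
  gpower (locd (mderD k) (mderM k) g +
          g * \sum_i loc_of (fprod f) (s i)%:MP * dlog (@mder K n) f k i).
Proof. by rewrite [LHS]dactX dmonU. Qed.

Definition fs : M := gpower 1.
(* f_1^(s_1+1) ... f_p^(s_p+1) := f_1 ... f_p * f_1^s_1 ... f_p^s_p *)
Definition fs1 : M := gpower (loc_of (fprod f) (fprod f)).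

Definition functional_eq (b : K) : Prop :=
  exists P : weyl n K, weylC b%:MP *: fs = P *: fs1.
End PowerModuleTheory.
Arguments gpower {K n p} s {f} g.

(* C[x, s] is encoded as {mpoly {mpoly C[p]}[n]} and A_n(C)[s_1, ..., s_p],
   with central s_i, as weyl n {mpoly C[p]}, the Weyl algebra over C[s]. *)
Definition bernstein_ideal (F : fieldType) (n p : nat)
    (f : 'I_p -> {mpoly F[n]}) (b : {mpoly F[p]}) : Prop :=
  functional_eq (fun i : 'I_p => 'X_i : {mpoly F[p]})
    (fun i => map_mpoly (@mpolyC p F) (f i)) b.

Definition form_poly (F : fieldType) (n : nat) (l : 'Hom('rV[F]_n, F^o)) :
    {mpoly F[n]} :=
  \sum_(j < n) l (delta_mx 0 j) *: 'X_j.

(* Main.v *)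
(* If v_1, ..., v_p is dual to l_1, ..., l_p, the derivations along the v_i,
   applied in turn to l_1^(s_1+1) ... l_p^(s_p+1), give
   \prod_i (s_i + 1) l_1^s_1 ... l_p^s_p.  Conversely, at s_i = -1 the factor
   l_i^(s_i+1) is 1, so the Weyl algebra applied to l_1^(s_1+1) ... l_p^(s_p+1)
   never creates a pole along l_i = 0; in terms of coefficients, b at s_i = -1
   is l_i times a fraction without l_i in the denominator.  Evaluating where
   l_i = 0 and the other forms are 1 gives b = 0 at s_i = -1.  So every s_i + 1
   divides b, hence so does their product. *)
Require Import Defs.
From HB Require Import structures.
From mathcomp Require Import all_boot all_order all_algebra ring.
From mathcomp Require Import reals complex mpoly.
Import GRing.Theory.
Local Open Scope ring_scope.
Set Implicit Arguments.
Unset Strict Implicit.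
Unset Printing Implicit Defensive.

(** * Functional equations in the localized power module *)

Section PowerModule.
Context (K : idomainType) (n p : nat) (s : 'I_p -> K).
Context (f : 'I_p -> {mpoly K[n]}).
Local Notation A := {mpoly K[n]}.
Local Notation h := (Defs.fprod f).
Local Notation L := (localization h).
Local Notation loc := (loc_of h).
Local Notation cofactor_prod i := (\prod_(j | j != i) f j).
Hypothesis h_neq0 : h != 0.

Lemma loc_inj : injective loc.
Proof. by move=> a b /(congr1 val)/= /eqP; rewrite tofrac_eq => /eqP. Qed.

Lemma loc_invK : loc h * loc_inv h = 1.
Proof. by apply: val_inj; rewrite /= divff // tofrac_eq0. Qed.

Lemma loc_mulI : injective ( *%R (loc h) : L -> L).
Proof.
apply: (can_inj (g := *%R (loc_inv h))) => q.
by rewrite mulrA [loc_inv h * _]mulrC loc_invK mul1r.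
Qed.

Lemma fprodE i : h = f i * cofactor_prod i.
Proof. by rewrite /Defs.fprod (bigD1 i). Qed.

(** The logarithmic derivative [\sum_i s i * d_k (f i) / f i] multiplied by [h]. *)
Definition dlog_num (k : 'I_n) : A :=
  \sum_i (s i)%:MP * ((f i)^`M(k) * cofactor_prod i).

Lemma loc0 : loc 0 = 0.
Proof. by apply: val_inj; rewrite /= tofrac0. Qed.

Lemma loc_sum (I : Type) (r : seq I) (G : I -> A) :
  loc (\sum_(i <- r) G i) = \sum_(i <- r) loc (G i).
Proof. exact: (big_morph _ (@loc_ofD _ _) loc0). Qed.

Lemma pnabla_loc k (q : L) :
  loc h * pnabla s k q =
  loc h * locd (mderD k) (mderM k) q + loc (dlog_num k) * q.
Proof.
rewrite /pnabla /nabla mulrDr; congr (_ + _).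
rewrite mulrCA mulrC; congr (_ * _).
rewrite loc_sum mulr_sumr; apply: eq_bigr => i _.
by rewrite /dlog [RHS]loc_ofM mulrCA [loc h * _]mulrCA loc_invK mulr1.
Qed.

(** Differentiating [h ^+ m * q = w] gives the quotient rule for [w / h ^+ m]; each derivation costs
    one power of [h]. *)
Lemma pnabla_num k m (q : L) w : loc (h ^+ m) * q = loc w ->
  loc (h ^+ m.+1) * pnabla s k q =
  loc (w^`M(k) * h + w * dlog_num k - m%:R * h^`M(k) * w).
Proof.
move=> qE; rewrite exprSr loc_ofM -mulrA pnabla_loc mulrDr.
have := congr1 (locd (mderD k) (mderM k)) qE.
rewrite locdM !locd_of /mder => dqE.
(* The extra factor [h] avoids the exponent [m - 1]. *)
have dhm : (h ^+ m)^`M(k) * h = m%:R * h^`M(k) * h ^+ m.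
  elim: {qE dqE} m => [|m IH]; first by rewrite expr0 -mpolyC1 mderivC !mul0r.
  by rewrite exprS mderivM mulrDl -!mulrA IH mulrSr; ring.
rewrite !loc_ofD [loc (_ * h)]loc_ofM -dqE [loc (w * _)]loc_ofM.
have -> : loc (- (m%:R * h^`M(k) * w)) = - (loc (h ^+ m)^`M(k) * loc h * q).
  rewrite -[loc _ * loc h]loc_ofM dhm [loc (_ * h ^+ m)]loc_ofM.
  rewrite -[_ * q]mulrA qE -loc_ofM.
  by apply: (addIr (loc (m%:R * h^`M(k) * w))); rewrite -loc_ofD !addNr loc0.
rewrite -qE; ring.
Qed.

(* The q whose value at s i = -1 lies in f i * A[1 / prod_(j != i) f j]: there
   f i ^ (s i + 1) = 1, so this submodule is stable under the Weyl algebra.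
   The two are put over the common denominator h ^+ m. *)
Definition regular_at (i : 'I_p) (q : L) : Prop := exists m a c,
  loc (h ^+ m) * q = loc (f i ^+ m.+1 * a + (s i + 1)%:MP * c).

(** Each factor [h] contains a factor [f i], so the shape persists and two elements can share a
    denominator. *)
Lemma regular_atS i (q : L) m a c :
    loc (h ^+ m) * q = loc (f i ^+ m.+1 * a + (s i + 1)%:MP * c) ->
  forall r, exists a' c', loc (h ^+ (r + m)) * q =
    loc (f i ^+ (r + m).+1 * a' + (s i + 1)%:MP * c').
Proof.
move=> qE; elim=> [|r [a' [c' IH]]]; first by exists a, c.
exists (a' * cofactor_prod i), (c' * h).
rewrite addSn exprS loc_ofM -mulrA IH -loc_ofM.
by congr loc; rewrite (fprodE i) !exprS; ring.
Qed.

Lemma regular_atD i (q r : L) :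
  regular_at i q -> regular_at i r -> regular_at i (q + r).
Proof.
move=> [m [a [c qE]]] [m' [a' [c' rE]]].
have [b [d {}qE]] := regular_atS qE m'.
have [b' [d' {}rE]] := regular_atS rE m; rewrite [(m + m')%N]addnC in rE.
exists (m' + m)%N, (b + b'), (d + d').
by rewrite mulrDr qE rE -loc_ofD; congr loc; ring.
Qed.

Lemma regular_atZ i a (q : L) : regular_at i q -> regular_at i (a *: q).
Proof.
move=> [m [b [c qE]]]; exists m, (a * b), (a * c).
by rewrite loc_scaleE mulrCA qE -loc_ofM; congr loc; ring.
Qed.

(** Modulo [f i] only the summand of index [i] survives: every other cofactor contains [f i]. *)
Lemma dlog_numE i k : exists r,
  dlog_num k = (s i)%:MP * (f i)^`M(k) * cofactor_prod i + f i * r.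
Proof.
exists (\sum_(j | j != i) (s j)%:MP *
          ((f j)^`M(k) * \prod_(l | (l != j) && (l != i)) f l)).
rewrite /dlog_num (bigD1 i) //= -!mulrA; congr (_ + _).
rewrite mulr_sumr; apply: eq_bigr => j ji.
by rewrite (bigD1 i) ?(eq_sym i) //= !(mulrCA (f i)).
Qed.

(** The terms not divisible by [f i ^+ m.+2] or [s i + 1] are multiples of one product: [m.+1] from
    the power, [s i] from the logarithmic derivative, [- m] from the denominator. They add up to
    [s i + 1]. *)
Lemma regular_at_pnabla i k (q : L) :
  regular_at i q -> regular_at i (pnabla s k q).
Proof.
move=> [m [a [c /(pnabla_num k) qE]]].
have [r rE] := dlog_numE i k.
exists m.+1; set g := cofactor_prod i in rE.
exists (a^`M(k) * g + a * r - m%:R * a * g^`M(k)).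
exists (c^`M(k) * h + c * dlog_num k - m%:R * h^`M(k) * c
        + f i ^+ m.+1 * (f i)^`M(k) * a * g).
rewrite qE; congr loc.
have dfm : (f i ^+ m.+1)^`M(k) = m.+1%:R * (f i)^`M(k) * f i ^+ m.
  elim: {qE} m => [|m IH]; first by rewrite expr1 expr0; ring.
  by rewrite exprS mderivM IH !mulrSr !exprS; ring.
rewrite mderivD !mderivM mderivC dfm rE (fprodE i) -/g mderivM !exprS.
by rewrite mpolyCD mpolyC1 mulrSr; ring.
Qed.

Lemma regular_at_dact i P (q : L) :
  regular_at i q -> regular_at i (dact (@pnabla K n p s f) P q).
Proof.
move=> qi; rewrite /dact; elim: (msupp P) => [|m r IH].
  by rewrite big_nil; exists 0%N, 0, 0; rewrite !mulr0 addr0 loc0.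
rewrite big_cons; apply: regular_atD => //; apply: regular_atZ.
rewrite /dmon; elim: (enum 'I_n) => //= k e IHe.
by elim: (m k) => //= j IHj; apply: regular_at_pnabla.
Qed.

Lemma functional_eq_dvd i b : functional_eq s f b ->
  exists m a c, h ^+ m * b%:MP = f i ^+ m.+1 * a + (s i + 1)%:MP * c.
Proof.
case=> P; rewrite weylC_gpower mulr1 => bE.
have hi : regular_at i (loc h).
  (* The coefficient [h] of [fs1] is itself a multiple of [f i]. *)
  exists 0%N, (cofactor_prod i), 0.
  by rewrite mulr0 addr0 expr1 -fprodE expr0 loc_of1 mul1r.
have [m [a [c]]] := regular_at_dact P hi.
by rewrite -[dact _ _ _]bE -loc_ofM => /loc_inj; exists m, a, c.
Qed.

Lemma functional_eqM c b : functional_eq s f b -> functional_eq s f (c * b).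
Proof.
move=> [P bE]; exists (weylC c%:MP * P).
by rewrite -scalerA -bE mpolyCM weylCM scalerA.
Qed.

(* The operator is the product of the derivations theta i = \sum_k v i k d_k,
   which satisfy theta i (f i * f^s) = (s i + 1) * f^s. *)
Lemma functional_eq_dual (v : 'I_p -> 'I_n -> A) :
  (forall i j, \sum_k v i k * (f j)^`M(k) = (i == j)%:R) ->
  functional_eq s f (\prod_i (s i + 1)).
Proof.
move=> vf; pose dv i a := \sum_k v i k * a^`M(k).
have dvM i a b : dv i (a * b) = dv i a * b + a * dv i b.
  rewrite /dv mulr_suml mulr_sumr -big_split; apply: eq_bigr => k _ /=.
  by rewrite mderivM; ring.
have dvC i c : dv i c%:MP = 0.
  by rewrite /dv big1 // => k _; rewrite mderivC mulr0.
pose theta i : weyl n K := \sum_k weylC (v i k) * weylD K k.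
have thetaE i w : theta i *: gpower s (loc (f i * w)) =
    gpower s (loc ((s i + 1)%:MP * w + f i * dv i w)).
  have numE k : pnabla s k (loc (f i * w)) * loc h =
      loc ((f i * w)^`M(k) * h + f i * w * dlog_num k).
    rewrite [LHS]mulrC pnabla_loc locd_of -!loc_ofM -loc_ofD; congr loc.
    by rewrite /mder; ring.
  have -> : theta i *: gpower s (loc (f i * w)) =
      \sum_k loc (v i k) * pnabla s k (loc (f i * w)).
    rewrite scaler_suml; apply: eq_bigr => k _.
    by rewrite -scalerA weylD_gpower weylC_gpower.
  (* Multiplying by [h] reduces the claim to a polynomial identity. *)
  apply: loc_mulI; rewrite mulr_sumr -loc_ofM.
  under eq_bigr do rewrite mulrCA (mulrC (loc h)) numE -loc_ofM.
  rewrite -loc_sum; congr loc.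
  have -> : \sum_k v i k * ((f i * w)^`M(k) * h + f i * w * dlog_num k) =
      dv i (f i * w) * h + f i * w * \sum_k v i k * dlog_num k.
    rewrite /dv mulr_suml mulr_sumr -big_split.
    by apply: eq_bigr => k _ /=; ring.
  (* By duality [dv i] kills every [f j] with [j != i]. *)
  have -> : \sum_k v i k * dlog_num k = (s i)%:MP * cofactor_prod i.
    transitivity
      (\sum_k \sum_j (s j)%:MP * cofactor_prod j * (v i k * (f j)^`M(k))).
      apply: eq_bigr => k _; rewrite mulr_sumr.
      by apply: eq_bigr => j _; ring.
    rewrite exchange_big (bigD1 i) //= [X in _ + X]big1 ?addr0 => [|j ji].
      by rewrite -mulr_sumr vf eqxx mulr1.
    by rewrite -mulr_sumr vf eq_sym (negbTE ji) mulr0.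
  rewrite dvM [dv i (f i)]vf eqxx mulr1n (fprodE i) mpolyCD mpolyC1; ring.
(* The general [w] serves the induction: the head factor [f i] is moved into [w], as it is constant
   for the later [dv j], which act first. *)
suff prodE r w : uniq r -> (forall i, i \in r -> dv i w = 0) ->
    (\prod_(i <- r) theta i) *: gpower s (loc ((\prod_(i <- r) f i) * w)) =
    gpower s (loc (\prod_(i <- r) (s i + 1)%:MP * w)).
  exists (\prod_i theta i); rewrite weylC_gpower mulr1.
  have := prodE (index_enum 'I_p) 1 (index_enum_uniq _).
  rewrite !mulr1 -rmorph_prod /= => <- // i _.
  by rewrite -mpolyC1 dvC.
elim: r w => [|i r IH] w; first by rewrite !big_nil scale1r !mul1r.
rewrite /= => /andP[ir ur] dw; rewrite !big_cons -scalerA.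
have -> : f i * \prod_(j <- r) f j * w = (\prod_(j <- r) f j) * (f i * w).
  by ring.
rewrite IH // => [|j jr]; last first.
  rewrite dvM [dv j (f i)]vf dw ?inE ?jr ?orbT // mulr0 addr0.
  by case: eqVneq jr ir => [->->|] //; rewrite mul0r.
rewrite mulrCA thetaE; congr (gpower s (loc _)).
rewrite -rmorph_prod dvM dvC dw ?inE ?eqxx //=; ring.
Qed.

(** Applying [phi] to [functional_eq_dvd] removes the [c] term. Cancelling [f i ^+ m] before
    evaluating at [x] leaves a factor [f i] only on the right, so [phi b] times a nonzero value is
    0. *)
Lemma functional_eq_root (K' : idomainType) (phi : {rmorphism K -> K'})
    (x : 'I_n -> K') i b :
  phi (s i) = -1 -> map_mpoly phi (f i) != 0 ->
  (map_mpoly phi (f i)).@[x] = 0 ->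
  (forall j, j != i -> (map_mpoly phi (f j)).@[x] != 0) ->
  functional_eq s f b -> phi b = 0.
Proof.
move=> phis fi_neq0 fix0 fjx /(functional_eq_dvd i) [m [a [c]]].
move=> /(congr1 (map_mpoly phi)).
rewrite rmorphD !rmorphM !rmorphXn /= !map_mpolyC /= rmorphD rmorph1 phis addNr.
rewrite mpolyC0 mul0r addr0 (fprodE i) rmorphM exprMn exprSr -!mulrA.
move/(mulfI (expf_neq0 m fi_neq0))/(congr1 (meval x)).
rewrite !rmorphM rmorphXn /= mevalC fix0 mul0r => /eqP.
rewrite mulf_eq0 expf_eq0 => /orP[/andP[_]|/eqP //].
by rewrite !rmorph_prod prodf_seq_eq0 => /hasP[j _ /andP[/fjx /negbTE->]].
Qed.

End PowerModule.

(** * Specialization at [s_i = -1] and divisibility *)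

Section Specialization.
Context (F : fieldType) (p : nat).
Implicit Types (b q : {mpoly F[p]}) (i j : 'I_p).

Definition substN1 i : {mpoly F[p]} -> {mpoly F[p]} :=
  comp_mpoly [tuple if j == i then -1 else 'X_j | j < p].

HB.instance Definition _ i := GRing.RMorphism.on (substN1 i).

Lemma substN1X i j : substN1 i 'X_j = if j == i then -1 else 'X_j.
Proof. by rewrite /substN1 comp_mpolyXU -tnth_nth tnth_mktuple. Qed.

Lemma substN1C i a : substN1 i a%:MP = a%:MP.
Proof. exact: comp_mpolyC. Qed.

(** The polynomials with this property form a subring containing constants and variables. *)
Lemma substN1E i b : exists q, b = substN1 i b + q * ('X_i + 1).
Proof.
pose P c := exists q, c = substN1 i c + q * ('X_i + 1).
have PD c d : P c -> P d -> P (c + d).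
  move=> [q cE] [r dE]; exists (q + r).
  by rewrite {1}cE {1}dE rmorphD /=; ring.
have PM c d : P c -> P d -> P (c * d).
  move=> [q cE] [r dE]; exists (q * d + substN1 i c * r).
  by rewrite rmorphM /= {1}cE mulrDl {1}dE; ring.
have PC a : P a%:MP.
  by exists 0; rewrite substN1C mul0r addr0.
have PX j : P 'X_j.
  rewrite /P substN1X; case: eqP => [->|_]; first by exists 1; ring.
  by exists 0; rewrite mul0r addr0.
rewrite -/(P b); elim/mpolyind: b => [|a m c _ _ IH].
  by rewrite -mpolyC0; apply: PC.
apply: PD IH; rewrite -mul_mpolyC; apply: (PM) => //.
rewrite mpolyXE_id; apply: (big_ind P) => [||j _]; [exact: PC 1|exact: PM|].
by elim: (m j) => [|k IH]; [exact: PC 1|rewrite exprS; apply: PM].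
Qed.

(** Factors are split off one by one: [substN1 i] fixes the other factors, which are nonzero, so in
    a domain it must kill the quotient. *)
Lemma dvd_prod_subst b : (forall i, substN1 i b = 0) ->
  exists q, b = q * \prod_(i < p) ('X_i + 1).
Proof.
move=> b0; elim: (index_enum _) (index_enum_uniq 'I_p) => [|i r IH] /=.
  by exists b; rewrite big_nil mulr1.
move=> /andP[ir /IH[q bE]]; have [c qE] := substN1E i q.
exists c; rewrite big_cons mulrA {1}bE {1}qE.
suff -> : substN1 i q = 0 by rewrite add0r.
move/eqP: (b0 i); rewrite bE rmorphM mulf_eq0 rmorph_prod /=.
rewrite prodf_seq_eq0 => /orP[/eqP //|/hasP[j jr]].
rewrite rmorphD rmorph1 /= substN1X; case: (eqVneq j i) jr ir => [->->//|_ _ _].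
move/eqP/(congr1 (mcoeff 0)).
rewrite mcoeffD mcoeffX mcoeff1 mcoeff0 mnm1_eq0 eqxx add0r.
by move/eqP; rewrite oner_eq0.
Qed.
End Specialization.

(** * Dual vectors and the ideal of independent forms *)

Section LinearForms.
Context (F : fieldType) (n p : nat) (l : p.-tuple 'Hom('rV[F]_n, F^o)).
Hypothesis l_free : free l.

Lemma form_delta i (u : 'rV[F]_n) :
  tnth l i u = \sum_k u 0 k * tnth l i (delta_mx 0 k) :> F.
Proof.
rewrite [in LHS](row_sum_delta u) linear_sum; apply: eq_bigr => k _.
by rewrite linearZ.
Qed.

(** The coefficient matrix of the forms has independent rows; the columns of a right inverse are the
    dual vectors. *)
Lemma free_dual : exists v : 'I_p -> 'rV[F]_n,
  forall i j, tnth l j (v i) = (i == j)%:R.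
Proof.
pose M := \matrix_(i < p, k < n) tnth l i (delta_mx 0 k).
have lE i u : tnth l i u = \sum_k u 0 k * M i k.
  by rewrite form_delta; apply: eq_bigr => k _; rewrite mxE.
have /row_freeP[B MB] : row_free M.
  apply: inj_row_free => u uM; apply/rowP => i; rewrite mxE.
  have /freeP l_indep := l_free; apply: (l_indep (u 0)); apply/lfunP => w.
  rewrite sum_lfunE lfunE /=.
  under eq_bigr => j _ do rewrite scale_lfunE -tnth_nth lE scaler_sumr.
  rewrite exchange_big big1 // => k _ /=.
  have /rowP/(_ k) := uM; rewrite !mxE => uMk.
  under eq_bigr do rewrite [_ *: _]mulrCA.
  by rewrite -mulr_sumr uMk mulr0.
exists (fun i => \row_k B k i) => i j; rewrite lE.
have /matrixP/(_ j i) := MB; rewrite !mxE eq_sym => <-.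
by apply: eq_bigr => k _; rewrite mxE mulrC.
Qed.

Local Notation K := {mpoly F[p]}.
Local Notation form i := (form_poly (tnth l i)).
Local Notation formK i := (map_mpoly (@mpolyC p F) (form i)).

Lemma formKE i : formK i = \sum_k (tnth l i (delta_mx 0 k))%:MP *: 'X_k.
Proof.
rewrite /form_poly raddf_sum; apply: eq_bigr => k _ /=.
by rewrite -mul_mpolyC rmorphM /= map_mpolyC map_mpolyX mul_mpolyC.
Qed.

Lemma formK_mevalE i (u : 'rV[F]_n) :
  (formK i).@[fun k => (u 0 k)%:MP] = (tnth l i u)%:MP.
Proof.
rewrite formKE form_delta !rmorph_sum; apply: eq_bigr => k _ /=.
by rewrite mevalZ mevalXU mulrC mpolyCM.
Qed.

Lemma formK_mderivE i (u : 'rV[F]_n) :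
  \sum_k (u 0 k)%:MP%:MP * (formK i)^`M(k) = (tnth l i u)%:MP%:MP.
Proof.
rewrite formKE form_delta rmorph_sum [RHS]rmorph_sum.
apply: eq_bigr => k _ /=; rewrite !mpolyCM; congr (_ * _).
rewrite linear_sum (bigD1 k) //= big1 ?addr0 => [|j jk].
  by rewrite mderivZ mderivX mnm1E eqxx scale1r -[X in (X - _)%MM]add0m addmK
      mpolyX0 -mul_mpolyC mulr1.
by rewrite mderivZ mderivX mnm1E (negbTE jk) scale0r scaler0.
Qed.

Lemma bernstein_ideal_free (b : K) :
  bernstein_ideal (fun i => form i) b <->
  exists q, b = q * \prod_(i < p) ('X_i + 1).
Proof.
have [v lv] := free_dual.
have form_neq0 i : formK i != 0.
  apply/eqP => /(congr1 (meval (fun k => (v i 0 k)%:MP))).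
  by rewrite formK_mevalE lv eqxx meval0 => /eqP; rewrite oner_eq0.
have h_neq0 : Defs.fprod (fun i => formK i) != 0.
  by apply/prodf_neq0.
split=> [bP|[q ->]]; last first.
  apply: functional_eqM.
  apply: (functional_eq_dual _ h_neq0 (v := fun i k => (v i 0 k)%:MP%:MP)) => i j.
  by rewrite formK_mderivE lv !rmorph_nat.
(* [u] is the evaluation point: the form [i] vanishes there, the others equal 1. *)
apply: dvd_prod_subst => i; pose u := \sum_(j | j != i) v j.
have lu j : tnth l j u = (j != i)%:R.
  rewrite linear_sum /=; case: eqVneq => [->|ji].
    by rewrite big1 // => k /negbTE ki; rewrite lv ki.
  rewrite (bigD1 j) //= lv eqxx big1 ?addr0 // => k /andP[_ /negbTE kj].
  by rewrite lv kj.
(* The forms have coefficients in [F], free of the [s_j]. *)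
have formKs j : map_mpoly (substN1 i) (formK j) = formK j.
  rewrite !formKE rmorph_sum; apply: eq_bigr => k _ /=.
  by rewrite map_mpolyZ map_mpolyX /= substN1C.
apply: (functional_eq_root h_neq0 (phi := substN1 i) (i := i)
  (x := fun k => (u 0 k)%:MP) _ _ _ _ bP) => [||| j ji].
- by rewrite /= substN1X eqxx.
- by rewrite formKs.
- by rewrite formKs formK_mevalE lu eqxx.
- by rewrite formKs formK_mevalE lu ji oner_neq0.
Qed.
End LinearForms.

Unset Implicit Arguments.

Theorem proposition5 (R : realType) (n p : nat)
    (hp : (1 <= p)%N) (hpn : (p <= n)%N)
    (l : p.-tuple 'Hom('rV[R[i]]_n, R[i]^o)) (hl : free l)
    (b : {mpoly R[i][p]}) :
  bernstein_ideal (fun i : 'I_p => form_poly (tnth l i)) b <->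
  exists q : {mpoly R[i][p]}, b = q * \prod_(i < p) ('X_i + 1).
Proof. exact: bernstein_ideal_free. Qed.
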